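(* Suppose that the regularized variational inequality problem (with operator $F:\mathbb{R}^d\to\mathbb{R}^d$ and regularizer $R$) has a unique solution $x^*$, that $F$ is $\mu$-quasi-strongly monotone and $\ell$-star-cocoercive ($\mu,\ell>0$), that $R$ is proper, lower semicontinuous and convex, and that the estimators $g_t$ satisfy the Estimator Assumption with constants $A,B,C,D_1,D_2\ge 0$, $\rho\in(0,1]$ and non-negative variables $\{\sigma_t\}_{t\ge0}$ (all as defined in the context). Let $M>\frac{B}{\rho}$, let $$0<\gamma\le\min\left\{\frac1\mu,\ \frac{1}{2(A+MC)}\right\},\qquad \tau:=\min\left\{\gamma\mu,\ p^2,\ \rho-\frac{B}{M}\right\},$$ and let $V_t:=\|x_t-x^*\|^2+\left(\frac{\gamma}{p}\right)^2\|h_t-F(x^* )\|^2+M\gamma^2\sigma_t^2$. Then the iterates of the algorithm ProxSkip-VIP with step-size $\gamma$ and probability $p\in(0,1]$ satisfy, for every $T\ge 0$, $$\mathbb{E}[V_T]\le(1-\tau)^T V_0+\frac{\gamma^2(D_1+MD_2)}{\tau}.$$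
   Context: **Regularized VIP.** Given $F:\mathbb{R}^d\to\mathbb{R}^d$ and $R:\mathbb{R}^d\to\mathbb{R}\cup\{+\infty\}$, find $x^*\in\mathbb{R}^d$ with $R(x^* )<\infty$ and $\langle F(x^* ),x-x^*\rangle+R(x)-R(x^* )\ge 0$ for all $x\in\mathbb{R}^d$. **Operator assumptions.** $F$ is $\mu$-quasi-strongly monotone if $\langle F(x)-F(x^* ),x-x^*\rangle\ge\mu\|x-x^*\|^2$ for all $x$, and $\ell$-star-cocoercive if $\langle F(x)-F(x^* ),x-x^*\rangle\ge\frac1\ell\|F(x)-F(x^* )\|^2$ for all $x$. **Proximal operator.** $\mathrm{prox}_{\alpha R}(x)=\arg\min_{v\in\mathbb{R}^d}\{R(v)+\frac{1}{2\alpha}\|v-x\|^2\}$, $\alpha>0$. **Algorithm ProxSkip-VIP.** Input: $x_0,h_0\in\mathbb{R}^d$, $\gamma>0$, $p\in(0,1]$. For $t=0,1,2,\dots$: form a stochastic estimator $g_t$ of $F(x_t)$; set $\hat x_{t+1}=x_t-\gamma(g_t-h_t)$; draw $\theta_t\in\{0,1\}$ with $\Pr(\theta_t=1)=p$, independently of the past and of $g_t$; if $\theta_t=1$ set $x_{t+1}=\mathrm{prox}_{\frac{\gamma}{p}R}\left(\hat x_{t+1}-\frac{\gamma}{p}h_t\right)$, otherwise $x_{t+1}=\hat x_{t+1}$; then set $h_{t+1}=h_t+\frac{p}{\gamma}(x_{t+1}-\hat x_{t+1})$. **Estimator Assumption.** Let $\mathcal{F}_t$ denote the history before $g_t$ is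 drawn (so that $x_t,h_t,\sigma_t$ are $\mathcal{F}_t$-measurable), and let $x_0,h_0,\sigma_0$ be non-random. There are constants $A,B,C,D_1,D_2\ge0$, $\rho\in(0,1]$ and (possibly random) non-negative variables $\{\sigma_t\}_{t\ge0}$ such that for all $t\ge0$: $\mathbb{E}[g_t\mid\mathcal{F}_t]=F(x_t)$, $$\mathbb{E}[\|g_t-F(x^* )\|^2\mid\mathcal{F}_t]\le 2A\langle F(x_t)-F(x^* ),x_t-x^*\rangle+B\sigma_t^2+D_1,$$ $$\mathbb{E}[\sigma_{t+1}^2\mid\mathcal{F}_t]\le 2C\langle F(x_t)-F(x^* ),x_t-x^*\rangle+(1-\rho)\sigma_t^2+D_2.$$ Convention: $1/0=+\infty$. *)

(* Defs.v *)
From HB Require Import structures.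
From mathcomp Require Export all_boot all_order all_algebra.
From mathcomp Require Export all_classical all_reals all_analysis.
From mathcomp Require Export measurable_realfun.
Export Order.TTheory GRing.Theory Num.Theory numFieldNormedType.Exports.
Set Implicit Arguments.
Unset Strict Implicit.
Unset Printing Implicit Defensive.

Local Open Scope classical_set_scope.
Local Open Scope ring_scope.

Section euclidean.
Context {R : realType} {n : nat}.
Implicit Types u v : 'rV[R]_n.

Definition dotv u v : R := \sum_(i < n) u 0 i * v 0 i.

(* The library norm on 'rV[R]_n is the sup norm; this is the Euclidean one. *)
Definition enorm u : R := Num.sqrt (dotv u u).

End euclidean.

Section vip.
Context {R : realType} {n : nat}.
Local Notation V := 'rV[R]_n.
Implicit Types (F : V -> V) (r : V -> \bar R) (x xs : V).

(* With proper_fun below, r takes its values in R U {+oo}. *)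
Definition proper_fun r := (forall x, r x != -oo%E) /\ (exists x, r x != +oo%E).

(* The endpoints t = 0, 1 are harmless, since 0 * +oo = 0 in \bar R. *)
Definition convex_efun r := forall (x y : V) (t : R), 0 <= t <= 1 ->
  (r (t *: x + (1 - t) *: y)%R <= t%:E * r x + (1 - t)%:E * r y)%E.

Definition vip_solution F r xs : Prop := (r xs < +oo)%E /\
  forall x, (0 <= (dotv (F xs) (x - xs))%:E + r x - r xs)%E.

Definition quasi_strongly_monotone F xs (mu : R) := forall x,
  mu * enorm (x - xs) ^+ 2 <= dotv (F x - F xs) (x - xs).

Definition star_cocoercive F xs (ell : R) := forall x,
  ell^-1 * enorm (F x - F xs) ^+ 2 <= dotv (F x - F xs) (x - xs).

(* For r proper, lower semicontinuous and convex and a > 0 the minimizer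
   exists and is unique, so the choice made by xget is the only possible one. *)
Definition prox (a : R) r x : V :=
  let obj v := (r v + ((2 * a)^-1 * enorm (v - x) ^+ 2)%:E)%E in
  xget 0 [set v | forall u, (obj v <= obj u)%E].

(* One trajectory of ProxSkip-VIP, for given realizations of the estimators g
   and of the coins theta. *)
Definition proxskip r (gamma p : R) (x0 h0 : V) (g : nat -> V)
    (theta : nat -> bool) (x h : nat -> V) : Prop :=
  [/\ x 0%N = x0, h 0%N = h0 & forall t,
    let xhat := x t - gamma *: (g t - h t) in
    x t.+1 = (if theta t then prox (gamma / p) r (xhat - (gamma / p) *: h t)
              else xhat) /\
    h t.+1 = h t + (p / gamma) *: (x t.+1 - xhat)].

Definition lyapunov F xs (gamma p M : R) (x h : V) (s : R) : R :=
  enorm (x - xs) ^+ 2 + (gamma / p) ^+ 2 * enorm (h - F xs) ^+ 2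
  + M * gamma ^+ 2 * s ^+ 2.

End vip.

Section probability.
Context {R : realType} {d : measure_display} {Om : measurableType d}.
Variable P : probability Om R.
Implicit Types (G H : set (set Om)) (A : set Om).

Definition filtration (Ft : nat -> set (set Om)) :=
  [/\ forall t, sigma_algebra setT (Ft t),
      forall t, Ft t `<=` measurable &
      forall s t, (s <= t)%N -> Ft s `<=` Ft t].

(* sigma-algebra generated by a random vector: the Borel sigma-algebra of R^n
   is generated by the coordinate maps. *)
Definition sigma_vec {n : nat} (X : Om -> 'rV[R]_n) : set (set Om) :=
  <<s \bigcup_(i in [set: 'I_n])
        g_sigma_algebra_preimage (fun w => X w 0 i) >>.

Definition independent_systems G H := forall A B, G A -> H B ->
  P (A `&` B) = (P A * P B)%E.

(* Y is a version of E[X | G], for X integrable or nonnegative; the latter case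
   does not presuppose that the expectation of X is finite, whence the
   extended-real values of Y. *)
Definition is_cond_exp G (X : Om -> R) (Y : Om -> \bar R) :=
  [/\ measurable_fun setT X,
      P.-integrable setT (EFin \o X) \/ (forall w, 0 <= X w),
      g_sigma_algebra_preimage Y `<=` G &
      forall A, G A -> (\int[P]_(w in A) Y w = \int[P]_(w in A) (X w)%:E)%E].

(* theta_t ~ Bernoulli(p), drawn independently of the past and of g_t. *)
Definition fresh_coins {n : nat} (Ft : nat -> set (set Om))
    (g : nat -> Om -> 'rV[R]_n) (p : R) (theta : nat -> Om -> bool) :=
  forall t, [/\ measurable_fun setT (theta t),
    P [set w | theta t w] = p%:E &
    independent_systems (g_sigma_algebra_preimage (theta t))
      <<s Ft t `|` sigma_vec (g t) >> ].

Record estimator_assumption {n : nat} (F : 'rV[R]_n -> 'rV[R]_n)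
    (xs : 'rV[R]_n) (Ft : nat -> set (set Om)) (x h g : nat -> Om -> 'rV[R]_n)
    (sigma : nat -> Om -> R) (A B C D1 D2 rho : R) : Prop :=
  EstimatorAssumption {
    est_filtration : filtration Ft ;
    est_adapted : forall t, [/\ sigma_vec (x t) `<=` Ft t,
      sigma_vec (h t) `<=` Ft t &
      g_sigma_algebra_preimage (sigma t) `<=` Ft t] ;
    est_sigma_ge0 : forall t w, 0 <= sigma t w ;
    est_unbiased : forall t (i : 'I_n),
      exists2 Y, is_cond_exp (Ft t) (fun w => g t w 0 i) Y &
        {ae P, forall w, Y w = (F (x t w) 0 i)%:E} ;
    est_second_moment : forall t,
      exists2 Y, is_cond_exp (Ft t) (fun w => enorm (g t w - F xs) ^+ 2) Y &
        {ae P, forall w, (Y w <=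
          (2 * A * dotv (F (x t w) - F xs) (x t w - xs)
           + B * sigma t w ^+ 2 + D1)%:E)%E} ;
    est_sigma : forall t,
      exists2 Y, is_cond_exp (Ft t) (fun w => sigma t.+1 w ^+ 2) Y &
        {ae P, forall w, (Y w <=
          (2 * C * dotv (F (x t w) - F xs) (x t w - xs)
           + (1 - rho) * sigma t w ^+ 2 + D2)%:E)%E} }.

End probability.

(* Main.v *)
Require Import Defs.
From mathcomp Require Import finmap ring lra.

(** The Lyapunov function contracts in expectation, up to a constant noise
    term, in every step; iterating E[V_(t+1)] <= (1 - tau) E[V_t] + c with
    c = gamma^2 (D1 + M D2) and summing the geometric series gives the bound.
    One step rests on three estimates.

    The coin.  Put hs = F xs, a = gamma / p and ys = xs - a hs.  A solution xs
    of the regularized problem is the proximal point of ys, and the proximal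
    map is firmly nonexpansive.  In the case of heads, h' is defined so that
    a (h' - h) = x' - xhat, whence a (h' - hs) = (x' - xs) - (y - ys) with y the
    argument of prox, and firm nonexpansiveness bounds
      |x' - xs|^2 + a^2 |h' - hs|^2  by  |y - ys|^2
    ([prox_firmly_nonexpansive], [coin_step_le]).  In the case of tails x' = xhat
    and h' = h.  Both y - ys and xhat - xs are x - xs - gamma (g - hs) plus a
    multiple of h - hs; in the average with weights p and 1 - p these multiples
    cancel to first order, which leaves
      |x - xs - gamma (g - hs)|^2 + (1 - p^2) a^2 |h - hs|^2
    ([coin_average], [coin_moment]).

    The estimator.  Expanding this square, unbiasedness turns the inner product
    <g - hs, x - xs> into s = E<F x - hs, x - xs>, and the two moment bounds
    control E|g - hs|^2 and E sigma'^2 by s, E sigma^2 and constants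
    ([step_moments]).

    The operator.  The total coefficient of s is - 2 gamma (1 - gamma (A + M C)),
    at most - gamma by the choice of gamma, and s >= mu E|x - xs|^2 by
    quasi-strong monotonicity ([lyapunov_descent]).

    Finiteness of the expectations travels along the induction: star-cocoercivity
    makes F Lipschitz relative to xs, so that s, and with it the moments of g and
    of the next iterates, are finite as soon as E[V_t] is.  Independence and
    conditioning both rest on one principle, [integral_mul_adapted]: two
    nonnegative functions with the same integral over every set of a
    sigma-algebra have the same integral against every nonnegative weight that is
    measurable with respect to it.  With the indicator of heads and the constant
    p it expresses the independence of the coin; with shifted versions of g and of
    its conditional expectation it gives the pull-out property. *)

Set Implicit Arguments.
Unset Strict Implicit.
Unset Printing Implicit Defensive.

Local Open Scope classical_set_scope.
Local Open Scope ring_scope.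

(** * The Euclidean inner product *)

Section dot_product.
Context {R : realType} {n : nat}.
Implicit Types u v w : 'rV[R]_n.

Lemma dotvC u v : dotv u v = dotv v u.
Proof. by apply: eq_bigr => i _; rewrite mulrC. Qed.

Lemma dotvDl u v w : dotv (u + v) w = dotv u w + dotv v w.
Proof. by rewrite -big_split; apply: eq_bigr => i _; rewrite mxE mulrDl. Qed.

Lemma dotvZl a u v : dotv (a *: u) v = a * dotv u v.
Proof. by rewrite mulr_sumr; apply: eq_bigr => i _; rewrite mxE mulrA. Qed.

Lemma dotvNl u v : dotv (- u) v = - dotv u v.
Proof. by rewrite -scaleN1r dotvZl mulN1r. Qed.

Lemma dotvDr u v w : dotv w (u + v) = dotv w u + dotv w v.
Proof. by rewrite !(dotvC w) dotvDl. Qed.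

Lemma dotvZr a u v : dotv u (a *: v) = a * dotv u v.
Proof. by rewrite !(dotvC u) dotvZl. Qed.

Lemma dotvNr u v : dotv u (- v) = - dotv u v.
Proof. by rewrite !(dotvC u) dotvNl. Qed.

Definition dotv_bilin := (dotvDl, dotvDr, dotvNl, dotvNr, dotvZl, dotvZr).

Lemma dotv_ge0 u : 0 <= dotv u u.
Proof. by apply: sumr_ge0 => i _; rewrite -expr2 sqr_ge0. Qed.

Lemma enorm_sqr u : enorm u ^+ 2 = dotv u u.
Proof. by rewrite sqr_sqrtr// dotv_ge0. Qed.

Lemma sqr_coord_le u i : u 0 i ^+ 2 <= dotv u u.
Proof.
rewrite /dotv (bigD1 i)//= -expr2 lerDl.
by apply: sumr_ge0 => j _; rewrite -expr2 sqr_ge0.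
Qed.

(** Weighted Young inequality, from expanding |u - l v|^2 >= 0. *)
Lemma young_dotv (l : R) u v : 0 < l ->
  dotv u v <= l^-1 / 2 * dotv u u + l / 2 * dotv v v.
Proof.
move=> l0; have := dotv_ge0 (u - l *: v).
rewrite !dotv_bilin (dotvC v u) => H.
rewrite -subr_ge0.
have -> : l^-1 / 2 * dotv u u + l / 2 * dotv v v - dotv u v =
  l^-1 / 2 * (dotv u u - l * dotv u v + - (l * (dotv u v - l * dotv v v))).
  by field; rewrite gt_eqF.
by apply: mulr_ge0; [rewrite divr_ge0 ?invr_ge0 ?ltW|lra].
Qed.

End dot_product.

(** * Operators that are star-cocoercive *)

Section operator.
Context {R : realType} {n : nat}.
Variables (F : 'rV[R]_n -> 'rV[R]_n) (xs : 'rV[R]_n) (ell : R).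
Hypotheses (ell0 : 0 < ell) (sc : star_cocoercive F xs ell).

(** Cocoercivity and Young give |F x - F xs|^2 / ell <= |F x - F xs|^2 / (2 ell)
    + ell |x - xs|^2 / 2; the first term on the right is absorbed. *)
Lemma star_cocoercive_lipschitz x :
  dotv (F x - F xs) (F x - F xs) <= ell ^+ 2 * dotv (x - xs) (x - xs).
Proof.
have := sc x; rewrite enorm_sqr => H1.
have H2 := young_dotv (F x - F xs) (x - xs) ell0.
have H3 : 2 * ell * (ell^-1 / 2 * dotv (F x - F xs) (F x - F xs)) <=
          2 * ell * (ell / 2 * dotv (x - xs) (x - xs)).
  by rewrite ler_pM2l ?mulr_gt0//; lra.
suff e : 2 * ell * (ell^-1 / 2 * dotv (F x - F xs) (F x - F xs)) =
  dotv (F x - F xs) (F x - F xs) by rewrite e in H3; lra.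
by field; rewrite gt_eqF.
Qed.

Lemma star_cocoercive_dotv_le x :
  dotv (F x - F xs) (x - xs) <= ell * dotv (x - xs) (x - xs).
Proof.
have := star_cocoercive_lipschitz x.
have := young_dotv (F x - F xs) (x - xs) ell0.
set a := dotv (F x - F xs) (F x - F xs); set b := dotv _ _; set c := dotv _ _.
move=> H1 H2.
have H3 : ell^-1 / 2 * a <= ell^-1 / 2 * (ell ^+ 2 * c).
  by apply: ler_wpM2l => //; rewrite divr_ge0 ?invr_ge0 ?ltW.
have e : ell^-1 / 2 * (ell ^+ 2 * c) = ell / 2 * c by field; rewrite gt_eqF.
by rewrite e in H3; lra.
Qed.

End operator.

(** * The proximal map at a solution *)

Section proximal_step.
Context {R : realType} {n : nat}.
Variables (F : 'rV[R]_n -> 'rV[R]_n) (r : 'rV[R]_n -> \bar R) (xs : 'rV[R]_n).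
Hypotheses (sol : vip_solution F r xs) (rproper : proper_fun r).
Variables (a : R) (y : 'rV[R]_n).
Hypothesis a0 : 0 < a.

Let obj v := (r v + ((2 * a)^-1 * enorm (v - y) ^+ 2)%:E)%E.

Lemma vip_reg_fin : r xs \is a fin_num.
Proof.
case: sol => s _; case: rproper => p _.
by rewrite fin_numElt lt_neqAle eq_sym p leNye.
Qed.

(** The variational inequality is an affine minorant of [r] that is exact at [xs];
    the quadratic term then makes the proximal objective coercive. *)
Lemma vip_minorant v : ((fine (r xs) - dotv (F xs) (v - xs))%:E <= r v)%E.
Proof.
have := sol.2 v; have := vip_reg_fin; case: (r xs) => // b _ /=.
have := rproper.1 v; case: (r v) => //= [c _|_ _]; last by rewrite leey.
by rewrite -!EFinD !lee_fin => *; lra.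
Qed.

(** Bounding [r] below by [vip_minorant] and completing the square, the objective
    at [v] exceeds its value at [xs] by at least
    (|v - xs + c|^2 - |c|^2) / (2 a); this is positive as soon as one coordinate
    of v - xs + c exceeds 1 + |c|^2 >= |c| in absolute value. *)
Lemma prox_objective_coercive (c v : 'rV[R]_n) (i : 'I_n) :
  c = xs - y - a *: F xs ->
  1 + dotv c c < `|v 0 i - xs 0 i + c 0 i| -> (obj xs < obj v)%E.
Proof.
move=> cE H.
apply: (@lt_le_trans _ _ ((fine (r xs) - dotv (F xs) (v - xs))%:E +
    ((2 * a)^-1 * enorm (v - y) ^+ 2)%:E)%E); last first.
  by rewrite leeD2r// vip_minorant.
rewrite /obj -[r xs]fineK ?vip_reg_fin//= -!EFinD lte_fin.
have c0 := dotv_ge0 c.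
have H1 : dotv c c < dotv (v - xs + c) (v - xs + c).
  apply: (lt_le_trans _ (sqr_coord_le _ i)); rewrite !mxE in H *.
  rewrite -real_normK ?num_real//.
  apply: (@lt_le_trans _ _ ((1 + dotv c c) ^+ 2)); first nra.
  by rewrite ler_sqr ?nnegrE; [exact: ltW|lra|].
rewrite -subr_gt0.
have -> : fine (r xs) - dotv (F xs) (v - xs) + (2 * a)^-1 * enorm (v - y) ^+ 2 -
   (fine (r xs) + (2 * a)^-1 * enorm (xs - y) ^+ 2) =
  (2 * a)^-1 * (dotv (v - xs + c) (v - xs + c) - dotv c c).
  rewrite !enorm_sqr cE !dotv_bilin !(dotvC xs v) !(dotvC y v) !(dotvC y xs).
  rewrite !(dotvC (F xs)) !(dotvC y (F xs)) !(dotvC xs (F xs)).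
  by field; rewrite gt_eqF.
by rewrite mulr_gt0// ?invr_gt0 ?mulr_gt0// subr_gt0.
Qed.

Hypotheses (rlsc : lower_semicontinuous r) (rconvex : convex_efun r).

Lemma continuous_sqdist :
  continuous (fun v : 'rV[R]_n => (2 * a)^-1 * enorm (v - y) ^+ 2).
Proof.
rewrite (_ : (fun _ => _) = fun v => (2 * a)^-1 * dotv (v - y) (v - y)); last first.
  by apply/funext => v; rewrite enorm_sqr.
have coordB i : continuous (fun v : 'rV[R]_n => (v - y) 0 i).
  rewrite (_ : (fun _ => _) = fun v : 'rV[R]_n => v 0 i - y 0 i); last first.
    by apply/funext => v; rewrite !mxE.
  move=> v; apply: continuousB; first exact: coord_continuous.
  exact: cst_continuous.
have dist : continuous (fun v : 'rV[R]_n => dotv (v - y) (v - y)).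
  apply: continuous_big; first exact: add_continuous.
  by move=> i _ v; apply: continuousM; exact: coordB.
by move=> v; exact: (continuousM (@cst_continuous _ _ _ v) (dist v)).
Qed.

Lemma prox_objective_lsc : lower_semicontinuous obj.
Proof.
move=> v b bv; set q := fun v => (2 * a)^-1 * enorm (v - y) ^+ 2.
have [e [be er]] : exists e, b - q v < e /\ (e%:E < r v)%E.
  move: bv; rewrite /obj -/(q v); have := rproper.1 v.
  case: (r v) => [c _| |//]; last by exists (b - q v + 1); rewrite ltry; split=> //; lra.
  rewrite -EFinD lte_fin => H; exists ((b - q v + c) / 2); rewrite lte_fin.
  by split; lra.
have [W nW We] := rlsc er.
have qv : b - e < q v by lra.
exists (W `&` [set u | b - e < q u]).
  by apply: filterI => //; exact: (cvgr_gt _ (@continuous_sqdist v)).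
move=> u [/We Wu /= qu]; rewrite /obj -/(q u).
move: Wu; case: (r u) => //= [c|_]; last by rewrite addye// ltry.
by rewrite -EFinD !lte_fin; lra.
Qed.

(** If there were no minimizer, the open sets where the objective exceeds its
    value at some u would cover a compact box outside of which the objective is
    larger than at [xs].  The best among the finitely many u of a subcover is
    then beaten by none of them, although it lies in the box. *)
Lemma prox_minimizer_exists : exists v, forall u, (obj v <= obj u)%E.
Proof.
apply: contrapT => /forallNP nomin.
have {}nomin v : exists u, (obj u < obj v)%E.
  by have /existsNP[u /negP] := nomin v; rewrite -ltNge; exists u.
pose c := xs - y - a *: F xs; pose b := 1 + dotv c c.
pose K := [set v : 'rV[R]_n | forall i,
  `[xs 0 i - c 0 i - b, xs 0 i - c 0 i + b]%classic (v 0 i)].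
have Kc : compact K.
  apply: (rV_compact (A := fun i => 
    `[xs 0 i - c 0 i - b, xs 0 i - c 0 i + b]%classic)) => i.
  exact: segment_compact.
have Kout v : ~ K v -> (obj xs < obj v)%E.
  move=> /existsNP[i vi]; apply: (@prox_objective_coercive c v i) => //.
  rewrite -/b ltNge; apply/negP => H; apply: vi.
  by move: H; rewrite /= in_itv/= ler_norml => /andP[H1 H2]; apply/andP; split; lra.
have Kxs : K xs by apply: contrapT => /Kout; rewrite ltxx.
pose D := [set u | obj u \is a fin_num].
move: (Kc); rewrite compact_cover.
move=> /(_ _ D (fun u => [set v | (obj u < obj v)%E]))[|v _|D' D'D KD'].
- move=> u /fineK <-; exact: (lower_semicontinuousP _).1 prox_objective_lsc _.
- have [u uv] := nomin v; exists u => //; rewrite /D/= fin_numElt.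
  rewrite (lt_le_trans uv) ?leey// andbT /obj.
  have := rproper.1 u; case: (r u) => //= s _; exact: ltNyr.
have [u0 u0D' u0xs] := KD' _ Kxs.
have [u uD' umin] : exists2 u, u \in D' & forall w, w \in D' -> (obj u <= obj w)%E.
  have [u _ umin] := @arg_minP _ _ D' [` u0D']%fset xpredT (fun i => obj (fsval i)) isT.
  exists (fsval u); first exact: fsvalP.
  by move=> w wD'; exact: (umin [` wD']%fset).
have [Ku|/Kout] := pselect (K u); last first.
  by move=> /(lt_trans u0xs); rewrite ltNge umin.
by have [w /umin uw] := KD' _ Ku; rewrite /= ltNge uw.
Qed.

(** Minimality of u along the segment towards [xs] gives
    r u - r xs <= <u - y, xs - u> / a, and the variational inequality gives
    r xs - r u <= <F xs, u - xs>.  Their sum is the monotonicity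
    <(y - ystar) - (u - xs), u - xs> >= 0, which is equivalent to the claim. *)
Lemma prox_firmly_nonexpansive (u := prox a r y) (ystar := xs - a *: F xs) :
  enorm (u - xs) ^+ 2 + enorm ((u - xs) - (y - ystar)) ^+ 2
  <= enorm (y - ystar) ^+ 2.
Proof.
have umin : forall v, (obj u <= obj v)%E.
  have [v vmin] := prox_minimizer_exists.
  by apply: (@xgetPex _ 0 [set v | forall u, (obj v <= obj u)%E]); exists v.
clearbody u.
have rxs := vip_reg_fin.
have ru : r u \is a fin_num.
  rewrite fin_numElt lt_neqAle eq_sym rproper.1 leNye /=.
  have := umin xs; rewrite /obj -(fineK rxs) -EFinD; case: (r u) => [s _|//|//].
  exact: ltry.
(* compare the objective at u and at t xs + (1 - t) u, and divide by t *)
have min_t t : 0 < t -> t <= 1 ->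
   fine (r u) - fine (r xs) <=
   a^-1 * dotv (u - y) (xs - u) + t * ((2 * a)^-1 * dotv (xs - u) (xs - u)).
  move=> t0 t1.
  have t01 : 0 <= t <= 1 by rewrite (ltW t0).
  have := le_trans (umin (t *: xs + (1 - t) *: u)) (leeD2r _ (rconvex xs u t01)).
  rewrite /obj -(fineK rxs) -(fineK ru) -!EFinM -!EFinD lee_fin /= => H.
  rewrite -(ler_pM2l t0) -subr_ge0.
  move: H; rewrite -subr_ge0; congr (0 <= _).
  rewrite !enorm_sqr !dotv_bilin !(dotvC u xs) !(dotvC y xs) !(dotvC y u).
  by field; rewrite gt_eqF.
(* let t tend to 0: an explicit small t contradicts the strict inequality *)
have {}min_t : fine (r u) - fine (r xs) <= a^-1 * dotv (u - y) (xs - u).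
  rewrite leNgt; apply/negP => H.
  set L := _ * _ in min_t H; set Q := _ * dotv (xs - u) (xs - u) in min_t.
  have Q0 : 0 <= Q by rewrite mulr_ge0 ?dotv_ge0// invr_ge0 mulr_ge0// ltW.
  set e := fine (r u) - fine (r xs) in min_t H.
  have := min_t ((e - L) / ((e - L) + 1 + Q)).
  rewrite divr_gt0 ?ler_pdivrMr; try lra.
  move=> /(_ isT); rewrite mul1r => /(_ ltac:(lra)).
  rewrite -subr_ge0.
  have -> : L + (e - L) / (e - L + 1 + Q) * Q - e =
    - ((e - L) * (e - L + 1) / (e - L + 1 + Q)).
    by field; lra.
  rewrite oppr_ge0 leNgt => /negP; apply.
  by rewrite divr_gt0 ?mulr_gt0//; lra.
have := vip_minorant u; rewrite -(fineK ru) lee_fin => H.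
have a_neq0 : a != 0 by rewrite gt_eqF.
have H2 : a * (fine (r u) - fine (r xs)) <= dotv (u - y) (xs - u).
  by rewrite -(mulVKf a_neq0 (dotv (u - y) _)) ler_pM2l.
have H3 : 0 <= a * (fine (r u) - (fine (r xs) - dotv (F xs) (u - xs))).
  by rewrite mulr_ge0 ?subr_ge0// ltW.
rewrite !enorm_sqr.
have : 0 <= 2 * (dotv (u - y) (xs - u) + a * dotv (F xs) (u - xs)) by lra.
rewrite /ystar -subr_ge0 => H4; rewrite -subr_ge0; move: H4; congr (0 <= _).
rewrite !dotv_bilin !(dotvC u xs) !(dotvC y xs) !(dotvC y u) !(dotvC (F xs)).
ring.
Qed.

End proximal_step.

(** * Integration against weights measurable for a sub-sigma-algebra *)

Section sub_sigma_algebra.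
Context {R : realType} {d : measure_display} {Om : measurableType d}.
Variables (mu : {measure set Om -> \bar R}) (G : set (set Om)).
Hypothesis GM : G `<=` measurable.

(** Measurability with respect to <<s G>> rather than to the ambient
    sigma-algebra of the sample space. *)
Definition adapted_to {d'} {T' : measurableType d'} (f : Om -> T') :=
  measurable_fun (setT : set (g_sigma_algebraType G)) (f : g_sigma_algebraType G -> T').

Lemma generated_sub_measurable : <<s G >> `<=` @measurable d Om.
Proof. apply: smallest_sub => //; exact: sigma_algebra_measurable. Qed.

Lemma adapted_measurable d' (T' : measurableType d') (f : Om -> T') :
  adapted_to f -> measurable_fun setT f.
Proof.
by move=> mf _ B mB; apply: generated_sub_measurable; exact: mf measurableT B mB.
Qed.

Import HBNNSimple.

(** The hypothesis on a and b is the claim for indicators Z; linearity extends it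
    to simple functions and monotone convergence to all Z >= 0. *)
Lemma integral_mul_adapted (a b Z : Om -> R) :
  measurable_fun setT a -> measurable_fun setT b ->
  (forall w, 0 <= a w) -> (forall w, 0 <= b w) ->
  (forall A, <<s G >> A ->
    (\int[mu]_(w in A) (a w)%:E = \int[mu]_(w in A) (b w)%:E)%E) ->
  adapted_to Z -> (forall w, 0 <= Z w) ->
  (\int[mu]_w (Z w * a w)%:E = \int[mu]_w (Z w * b w)%:E)%E.
Proof.
move=> ma mb a0 b0 ab mZ Z0.
have mEZ : measurable_fun (setT : set (g_sigma_algebraType G))
    (EFin \o Z : g_sigma_algebraType G -> \bar R).
  by apply/measurable_EFinP.
pose Zn := nnsfun_approx measurableT mEZ.
have ZnZ w : (EFin \o Zn ^~ w) @ \oo --> (Z w)%:E.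
  by apply: (cvg_nnsfun_approx measurableT mEZ) => // x _; rewrite lee_fin.
have Znd w : nondecreasing_seq (Zn ^~ w).
  by move=> m k mk; have /lefP := nd_nnsfun_approx measurableT mEZ mk; exact.
have mZn k : measurable_fun setT (Zn k : Om -> R).
  by apply: adapted_measurable; exact: measurable_funP.
have Zn0 k w : 0 <= Zn k w by [].
have lim_int (c : Om -> R) : measurable_fun setT c -> (forall w, 0 <= c w) ->
  (\int[mu]_w (Z w * c w)%:E)%E = limn (fun k => \int[mu]_w (Zn k w * c w)%:E)%E.
  move=> mc c0; rewrite -monotone_convergence//.
  - apply: eq_integral => w _; apply/esym/cvg_lim => //.
    under eq_fun do rewrite EFinM.
    by rewrite EFinM; apply: cvgeZr => //; exact: ZnZ.
  - by move=> k; apply/measurable_EFinP; exact: measurable_funM.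
  - by move=> k w _; rewrite lee_fin mulr_ge0.
  - by move=> w _ m k mk; rewrite lee_fin ler_wpM2r// Znd.
rewrite !lim_int//; congr (limn _); apply/funext => k.
have simple_int (c : Om -> R) : measurable_fun setT c -> (forall w, 0 <= c w) ->
  (\int[mu]_w (Zn k w * c w)%:E =
   \sum_(y \in range (Zn k)) (y%:E * \int[mu]_(w in Zn k @^-1` [set y]) (c w)%:E))%E.
  move=> mc c0.
  have mpre y : measurable (Zn k @^-1` [set y] : set Om).
    by rewrite -[X in measurable X]setTI; exact: mZn.
  have piece0 y w : (0 <= (y * \1_(Zn k @^-1` [set y]) w)%:E * (c w)%:E)%E.
    by rewrite mule_ge0 ?lee_fin//; exact: nnfun_muleindic_ge0.
  transitivity (\int[mu]_w (\sum_(y \in range (Zn k))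
      ((y * \1_(Zn k @^-1` [set y]) w)%:E * (c w)%:E)))%E.
    apply: eq_integral => w _.
    rewrite -ge0_mule_fsuml => [|y]; last exact: nnfun_muleindic_ge0.
    by rewrite fsumEFin // -fimfunE EFinM.
  rewrite ge0_integral_fsum//; last first.
    move=> y; apply: emeasurable_funM; apply/measurable_EFinP => //.
    by apply: measurable_funM => //; exact: measurable_indic.
  apply: eq_fsbigr => y /set_mem[v _ yE].
  rewrite [in RHS]integral_mkcond -ge0_integralZl//.
  - apply: eq_integral => w _.
    by rewrite (epatch_indic (fun w => (c w)%:E)) EFinM -muleA (muleC (\1_ _ _)%:E).
  - rewrite (epatch_indic (fun w => (c w)%:E)).
    apply: emeasurable_funM; apply/measurable_EFinP => //.
  - by move=> w _; rewrite erestrict_ge0// => ? _; rewrite lee_fin.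
  - by rewrite lee_fin -yE.
rewrite !simple_int//; apply: eq_fsbigr => y _; congr (_ * _)%E.
apply: ab; rewrite -[X in <<s G>> X]setTI.
exact: (measurable_funP (Zn k) measurableT [set y]).
Qed.

End sub_sigma_algebra.

(** * Finite means, pull-out and independence *)

Section finite_mean.
Context {R : realType} {d : measure_display} {Om : measurableType d}.
Variable P : probability Om R.
Implicit Types (f g : Om -> R) (m : R).

(** Integrability and the value of the integral are kept together, so that the
    estimates on expectations become linear arithmetic in the real numbers m. *)
Definition has_mean f m :=
  P.-integrable setT (EFin \o f) /\ (\int[P]_w (f w)%:E = m%:E)%E.

Lemma has_mean_measurable f m : has_mean f m -> measurable_fun setT f.
Proof. by case=> /measurable_int/measurable_EFinP. Qed.

Lemma has_mean_integrable f :
  P.-integrable setT (EFin \o f) -> exists m, has_mean f m.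
Proof.
move=> fi; exists (fine (\int[P]_w (f w)%:E)%E); split => //.
by rewrite fineK//; exact: integrable_fin_num fi.
Qed.

Lemma has_mean_unique f m m' : has_mean f m -> has_mean f m' -> m = m'.
Proof. by move=> [_ fm] [_]; rewrite fm => -[]. Qed.

Lemma eq_has_mean f g m : f =1 g -> has_mean f m -> has_mean g m.
Proof. by move=> /funext ->. Qed.

Lemma has_mean_cst m : has_mean (fun=> m) m.
Proof.
split; first exact: finite_measure_integrable_cst.
transitivity (m%:E * P setT)%E; first exact: (integral_cst P measurableT m%:E).
by rewrite probability_setT mule1.
Qed.

Lemma has_meanD f g m m' : has_mean f m -> has_mean g m' ->
  has_mean (fun w => f w + g w) (m + m').
Proof.
move=> [fi fm] [gi gm]; split; first exact: integrableD fi gi.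
by under eq_integral do rewrite EFinD; rewrite integralD// fm gm.
Qed.

Lemma has_meanZ k f m : has_mean f m -> has_mean (fun w => k * f w) (k * m).
Proof.
move=> [fi fm]; split; first exact: integrableZl fi.
by under eq_integral do rewrite EFinM; rewrite integralZl// fm.
Qed.

Lemma has_mean_sum n (f : 'I_n -> Om -> R) (m : 'I_n -> R) :
  (forall i, has_mean (f i) (m i)) ->
  has_mean (fun w => \sum_(i < n) f i w) (\sum_(i < n) m i).
Proof.
move=> fm; rewrite (_ : (fun _ => _) = \sum_(i < n) f i); last first.
  by apply/funext => w; rewrite fct_sumE.
elim/big_ind2 : _ => //; first exact: has_mean_cst.
by move=> ? ? ? ?; exact: has_meanD.
Qed.

(** The difference g - f agrees almost everywhere with its positive part, whose
    integral is nonnegative. *)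
Lemma le_has_mean f g m m' : {ae P, forall w, f w <= g w} ->
  has_mean f m -> has_mean g m' -> m <= m'.
Proof.
move=> fg fm gm'; rewrite -subr_ge0.
have [hi hm] := has_meanD gm' (has_meanZ (-1) fm).
move: hm; rewrite mulN1r -lee_fin => <-.
have mh := measurable_int _ hi.
rewrite (ae_eq_integral (fun w => (Num.max (g w + -1 * f w) 0)%:E))//.
- by apply: integral_ge0 => w _; rewrite lee_fin le_max lexx orbT.
- apply/measurable_EFinP; apply: measurable_maxr => //; exact/measurable_EFinP.
- apply: filterS fg => w fgw _; congr (_%:E).
  by rewrite max_l// mulN1r subr_ge0.
Qed.

Lemma has_mean_dominated f g m : measurable_fun setT f ->
  {ae P, forall w, `|f w| <= g w} -> has_mean g m -> exists m', has_mean f m'.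
Proof.
move=> mf fg [gi gm]; apply: has_mean_integrable; apply/integrableP; split.
  exact/measurable_EFinP.
have /integrableP[mg] := gi; apply: le_lt_trans.
apply: ae_ge0_le_integral => //.
- by apply: measurableT_comp => //; exact/measurable_EFinP.
- exact: measurableT_comp.
- apply: filterS fg => w fgw _ /=; rewrite lee_fin.
  exact: (le_trans fgw (ler_norm _)).
Qed.

Lemma has_mean_ge0_bounded f m : measurable_fun setT f -> (forall w, 0 <= f w) ->
  (\int[P]_w (f w)%:E <= m%:E)%E -> exists2 m', has_mean f m' & m' <= m.
Proof.
move=> mf f0 fm.
have [|m' fm'] := @has_mean_integrable f.
  apply/integrableP; split; first exact/measurable_EFinP.
  rewrite (eq_integral (fun w => (f w)%:E)); last by move=> w _ /=; rewrite ger0_norm.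
  exact: le_lt_trans fm (ltry _).
by exists m' => //; rewrite -lee_fin -fm'.2.
Qed.

Lemma has_mean_mul f g m m' : measurable_fun setT f -> measurable_fun setT g ->
  has_mean (fun w => f w ^+ 2) m -> has_mean (fun w => g w ^+ 2) m' ->
  exists m'', has_mean (fun w => f w * g w) m''.
Proof.
move=> mf mg fm gm; apply: has_mean_dominated (has_meanD fm gm).
  exact: measurable_funM.
apply: aeW => w; rewrite ler_norml.
have := sqr_ge0 (f w + g w); have := sqr_ge0 (f w - g w).
by rewrite !expr2 => *; apply/andP; split; nra.
Qed.

Lemma has_mean_of_sqr f m : measurable_fun setT f ->
  has_mean (fun w => f w ^+ 2) m -> exists m', has_mean f m'.
Proof.
move=> mf fm.
apply: has_mean_dominated (has_meanD fm (has_mean_cst 1)) => //.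
apply: aeW => w; rewrite ler_norml; have := sqr_ge0 (f w - 1).
by have := sqr_ge0 (f w + 1); rewrite !expr2 => *; apply/andP; split; nra.
Qed.

End finite_mean.

Section pull_out.
Context {R : realType} {d : measure_display} {Om : measurableType d}.
Variables (P : probability Om R) (G : set (set Om)).
Hypothesis GM : G `<=` measurable.

(** Adding |g| + |Y| to both g and Y makes them nonnegative without disturbing the
    equality of their integrals over the sets of G. *)
Let pull_out_ge0 (Z g Y : Om -> R) a b : adapted_to G Z -> (forall w, 0 <= Z w) ->
  P.-integrable setT (EFin \o g) -> P.-integrable setT (EFin \o Y) ->
  (forall A, <<s G >> A ->
    (\int[P]_(w in A) (g w)%:E = \int[P]_(w in A) (Y w)%:E)%E) ->
  has_mean P (fun w => Z w * (g w + (`|g w| + `|Y w|))) a ->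
  has_mean P (fun w => Z w * (Y w + (`|g w| + `|Y w|))) b ->
  a = b.
Proof.
move=> mZ Z0 gi Yi gY [_ am] [_ bm].
have mg : measurable_fun setT g by apply/measurable_EFinP; exact: measurable_int gi.
have mY : measurable_fun setT Y by apply/measurable_EFinP; exact: measurable_int Yi.
have mN : measurable_fun setT (fun w => `|g w| + `|Y w|).
  by apply: measurable_funD; exact: measurableT_comp.
have absi : P.-integrable setT (EFin \o (fun w => `|g w| + `|Y w|)).
  exact: (integrableD measurableT (integrable_norm gi) (integrable_norm Yi)).
suff : a%:E = b%:E by case.
rewrite -am -bm; apply: (integral_mul_adapted GM) => //.
- exact: measurable_funD.
- exact: measurable_funD.
- by move=> w; rewrite addrA addr_ge0// -lerBlDl sub0r -normrN ler_norm.
- by move=> w; rewrite addrCA addr_ge0// -lerBlDl sub0r -normrN ler_norm.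
- move=> A GA; have mA := generated_sub_measurable GM GA.
  have iA f : P.-integrable setT f -> P.-integrable A f.
    by apply: integrableS.
  under eq_integral do rewrite EFinD.
  under [RHS]eq_integral do rewrite EFinD.
  rewrite integralD//; [|exact: iA..].
  by rewrite [RHS]integralD//; [rewrite gY|exact: iA..].
Qed.

(** The pull-out property E[Z g] = E[Z E[g | G]] for square-integrable factors.  A
    signed Z is handled as the difference of the nonnegative weights |Z| + Z and
    |Z|, to each of which [pull_out_ge0] applies. *)
Lemma pull_out (Z g Y : Om -> R) mZ2 mg2 mY2 :
  adapted_to G Z -> adapted_to G Y -> measurable_fun setT g ->
  has_mean P (fun w => Z w ^+ 2) mZ2 -> has_mean P (fun w => g w ^+ 2) mg2 ->
  has_mean P (fun w => Y w ^+ 2) mY2 ->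
  (forall A, <<s G >> A ->
    (\int[P]_(w in A) (g w)%:E = \int[P]_(w in A) (Y w)%:E)%E) ->
  exists m, has_mean P (fun w => Z w * g w) m /\ has_mean P (fun w => Z w * Y w) m.
Proof.
move=> aZ aY mg Z2 g2 Y2 gY.
have mZ := adapted_measurable GM aZ; have mY := adapted_measurable GM aY.
have [_ [gi _]] := has_mean_of_sqr mg g2.
have [_ [Yi _]] := has_mean_of_sqr mY Y2.
have norm_sqr f m : has_mean P (fun w => f w ^+ 2) m ->
   has_mean P (fun w => `|f w| ^+ 2) m.
  by apply: eq_has_mean => w; rewrite real_normK// num_real.
have mnorm f : measurable_fun setT f -> measurable_fun setT (fun w : Om => `|f w : R|).
  by move=> mf; exact: measurableT_comp.
have [zg zgm] := has_mean_mul mZ mg Z2 g2.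
have [zY zYm] := has_mean_mul mZ mY Z2 Y2.
have [zg' zgm'] := has_mean_mul mZ (mnorm _ mg) Z2 (norm_sqr _ _ g2).
have [zY' zYm'] := has_mean_mul mZ (mnorm _ mY) Z2 (norm_sqr _ _ Y2).
have [ng ngm] := has_mean_mul (mnorm _ mZ) mg (norm_sqr _ _ Z2) g2.
have [nY nYm] := has_mean_mul (mnorm _ mZ) mY (norm_sqr _ _ Z2) Y2.
have [ng' ngm'] := has_mean_mul (mnorm _ mZ) (mnorm _ mg)
  (norm_sqr _ _ Z2) (norm_sqr _ _ g2).
have [nY' nYm'] := has_mean_mul (mnorm _ mZ) (mnorm _ mY)
  (norm_sqr _ _ Z2) (norm_sqr _ _ Y2).
exists zg; split => //.
suff -> : zg = zY by [].
have anZ : adapted_to G (fun w => `|Z w|) by exact: measurableT_comp.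
have e1 : ng + (ng' + nY') = nY + (ng' + nY').
  apply: (pull_out_ge0 anZ _ gi Yi gY) => //.
  - apply: eq_has_mean (has_meanD ngm (has_meanD ngm' nYm')) => w.
    by rewrite !mulrDr.
  - apply: eq_has_mean (has_meanD nYm (has_meanD ngm' nYm')) => w.
    by rewrite !mulrDr.
have e2 : ng + (ng' + nY') + (zg + (zg' + zY')) = nY + (ng' + nY') + (zY + (zg' + zY')).
  apply: (@pull_out_ge0 (fun w => `|Z w| + Z w) _ _ _ _ _ _ gi Yi gY) => //.
  - exact: measurable_funD.
  - by move=> w; rewrite -lerBlDr sub0r -normrN ler_norm.
  - apply: eq_has_mean (has_meanD (has_meanD ngm (has_meanD ngm' nYm'))
      (has_meanD zgm (has_meanD zgm' zYm'))) => w.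
    by rewrite !mulrDr !mulrDl; ring.
  - apply: eq_has_mean (has_meanD (has_meanD nYm (has_meanD ngm' nYm'))
      (has_meanD zYm (has_meanD zgm' zYm'))) => w.
    by rewrite !mulrDr !mulrDl; ring.
lra.
Qed.

(** Independence says that the indicator of C and the constant p have the same
    integral over each set of <<s G>>, which is the hypothesis of
    [integral_mul_adapted]. *)
Lemma has_mean_mul_indep (C : set Om) (U : Om -> R) (p m : R) :
  measurable C -> 0 <= p ->
  (forall A, <<s G >> A -> P (C `&` A) = (p%:E * P A)%E) ->
  adapted_to G U -> (forall w, 0 <= U w) -> has_mean P U m ->
  has_mean P (fun w => U w * \1_C w) (p * m).
Proof.
move=> mC p0 CG aU U0 Um.
have mU := has_mean_measurable Um.
have [m' Cm'] : exists m', has_mean P (fun w => U w * \1_C w) m'.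
  apply: has_mean_dominated Um; first exact: measurable_funM.
  by apply: aeW => w; rewrite normrM (ger0_norm (U0 w)) ger0_norm// ler_piMr.
suff -> : p * m = m' by [].
have pm := has_meanZ p Um.
suff : (p * m)%:E = m'%:E by case.
rewrite -pm.2 -Cm'.2.
rewrite (eq_integral (fun w => (U w * cst p w)%:E)); last by move=> w _; rewrite mulrC.
apply: (integral_mul_adapted GM) => // A GA.
have mA := generated_sub_measurable GM GA.
transitivity (P (C `&` A)); last by apply/esym; exact: integral_indic.
by rewrite CG//; exact: (integral_cst P mA p%:E).
Qed.

End pull_out.

(** * Random vectors and conditional bounds *)

Section random_vectors.
Context {R : realType} {d : measure_display} {Om : measurableType d} {n : nat}.
Implicit Types X Y : Om -> 'rV[R]_n.

(** Measurability is required coordinatewise, in accordance with [sigma_vec]. *)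
Definition vmeasurable X := forall i, measurable_fun setT (fun w => X w 0 i).

Lemma vmeasurable_cst v : vmeasurable (fun=> v).
Proof. by move=> i; exact: measurable_cst. Qed.

Lemma vmeasurableD X Y : vmeasurable X -> vmeasurable Y ->
  vmeasurable (fun w => X w + Y w).
Proof.
move=> mX mY i; rewrite (_ : (fun _ => _) = (fun w => X w 0 i + Y w 0 i)).
  exact: measurable_funD.
by apply/funext => w; rewrite mxE.
Qed.

Lemma vmeasurableZ a X : vmeasurable X -> vmeasurable (fun w => a *: X w).
Proof.
move=> mX i; rewrite (_ : (fun _ => _) = (fun w => a * X w 0 i)).
  exact: measurable_funM.
by apply/funext => w; rewrite mxE.
Qed.

Lemma vmeasurableB X Y : vmeasurable X -> vmeasurable Y ->
  vmeasurable (fun w => X w - Y w).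
Proof.
move=> mX mY; rewrite (_ : (fun _ => _) = (fun w => X w + -1 *: Y w)).
  by apply: vmeasurableD => //; exact: vmeasurableZ.
by apply/funext => w; rewrite scaleN1r.
Qed.

Lemma vmeasurable_shift X v : vmeasurable X -> vmeasurable (fun w => X w - v).
Proof. by move=> mX; exact: vmeasurableB mX (vmeasurable_cst v). Qed.

Lemma measurable_dotv X Y : vmeasurable X -> vmeasurable Y ->
  measurable_fun setT (fun w => dotv (X w) (Y w)).
Proof. by move=> mX mY; apply: measurable_sum => i; exact: measurable_funM. Qed.

Lemma sigma_vec_measurable X : vmeasurable X -> sigma_vec X `<=` measurable.
Proof.
move=> mX; apply: smallest_sub; first exact: sigma_algebra_measurable.
by move=> _ [i _ [B mB <-]]; exact: mX.
Qed.

End random_vectors.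

Section adapted_vectors.
Context {R : realType} {d : measure_display} {Om : measurableType d} {n : nat}.
Variable (G : set (set Om)).

Definition vadapted (X : Om -> 'rV[R]_n) :=
  vmeasurable (X : g_sigma_algebraType G -> 'rV[R]_n).

Lemma sigma_vec_vadapted (X : Om -> 'rV[R]_n) : sigma_vec X `<=` <<s G >> -> vadapted X.
Proof.
move=> XG i _ B mB; apply: XG; apply: sub_sigma_algebra.
by exists i => //; exists B.
Qed.

Lemma vadapted_measurable (X : Om -> 'rV[R]_n) : G `<=` measurable ->
  vadapted X -> vmeasurable X.
Proof. by move=> GM aX i; exact: (adapted_measurable GM (aX i)). Qed.

Lemma vadapted_shift (X : Om -> 'rV[R]_n) v :
  vadapted X -> vadapted (fun w => X w - v).
Proof. exact: vmeasurable_shift. Qed.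

Lemma preimage_adapted d' (T' : measurableType d') (f : Om -> T') :
  g_sigma_algebra_preimage f `<=` <<s G >> -> adapted_to G f.
Proof. by move=> fG _ B mB; apply: fG; exists B. Qed.

End adapted_vectors.

Section conditional_expectation.
Context {R : realType} {d : measure_display} {Om : measurableType d}.
Variables (P : probability Om R) (G : set (set Om)).
Hypotheses (Gsig : sigma_algebra setT G) (GM : G `<=` measurable).

(** Since Y is only known to be bounded above, its negative part may have any
    integral; it is dropped, and the positive part is compared with the bound. *)
Lemma cond_exp_mean_le (X bound : Om -> R) (Y : Om -> \bar R) b :
  (forall w, 0 <= X w) -> is_cond_exp P G X Y ->
  {ae P, forall w, 0 <= bound w /\ (Y w <= (bound w)%:E)%E} ->
  has_mean P bound b -> exists2 m, has_mean P X m & m <= b.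
Proof.
move=> X0 [mX _ YG XY] Yb mb.
have mbd := has_mean_measurable mb.
apply: has_mean_ge0_bounded => //.
have GT : G setT by case: Gsig => G0 GC _; rewrite -(setD0 setT); exact: GC.
have mY : measurable_fun setT Y.
  by move=> _ B mB; apply/GM/YG; exists B.
rewrite -(XY setT GT) integralE.
apply: (@le_trans _ _ (\int[P]_w (Y^\+ w))%E).
  rewrite -[leRHS]sube0 leeB//.
  by apply: integral_ge0.
have mmax : measurable_fun setT (fun w => (Num.max (bound w) 0)%:E).
  by apply/measurable_EFinP; exact: measurable_maxr.
have <- : (\int[P]_w (Num.max (bound w) 0)%:E = b%:E)%E.
  rewrite -mb.2; apply: ae_eq_integral => //; first exact/measurable_EFinP.
  by apply: filterS Yb => w [b0 _] _; rewrite max_l.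
apply: ae_ge0_le_integral => //.
- exact: measurable_funepos.
- by move=> w _; rewrite lee_fin le_max lexx orbT.
- apply: filterS Yb => w [b0 Yw] _; rewrite max_l// funeposE.
  by rewrite ge_max Yw lee_fin.
Qed.

End conditional_expectation.

(** * One coin toss *)

Section coin_step.
Context {R : realType} {n : nat}.
Variables (F : 'rV[R]_n -> 'rV[R]_n) (r : 'rV[R]_n -> \bar R) (xs : 'rV[R]_n).
Hypotheses (sol : vip_solution F r xs) (rproper : proper_fun r)
  (rlsc : lower_semicontinuous r) (rconvex : convex_efun r).
Variables (gamma p : R).
Hypotheses (gamma0 : 0 < gamma) (p0 : 0 < p).

(** Every point that occurs in the analysis of one step has this form relative to
    its target: e = gamma gives xhat - xs, e = gamma - gamma / p gives the
    deviation of the argument of prox, and e = 0 gives x - xs - gamma (g - F xs). *)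
Definition shifted_step (e : R) (x h g : 'rV[R]_n) : 'rV[R]_n :=
  (x - xs) - gamma *: (g - F xs) + e *: (h - F xs).

(** For heads, the second summand on the left is the residual of the proximal map,
    so that firm nonexpansiveness bounds the whole sum. *)
Lemma coin_step_le (x h g x' h' : 'rV[R]_n) (c : bool)
  (xhat := x - gamma *: (g - h)) :
  x' = (if c then prox (gamma / p) r (xhat - (gamma / p) *: h) else xhat) ->
  h' = h + (p / gamma) *: (x' - xhat) ->
  enorm (x' - xs) ^+ 2 + (gamma / p) ^+ 2 * enorm (h' - F xs) ^+ 2 <=
  if c then enorm (shifted_step (gamma - gamma / p) x h g) ^+ 2
  else enorm (shifted_step gamma x h g) ^+ 2
       + (gamma / p) ^+ 2 * enorm (h - F xs) ^+ 2.
Proof.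
have gp0 : 0 < gamma / p by rewrite divr_gt0.
have xhatE : xhat - xs = shifted_step gamma x h g.
  by apply/rowP => i; rewrite /shifted_step !mxE; ring.
case: c => x'E h'E; last first.
  by rewrite h'E x'E subrr scaler0 addr0 xhatE.
have := prox_firmly_nonexpansive sol rproper (xhat - (gamma / p) *: h) gp0 rlsc rconvex.
rewrite -x'E => H.
rewrite (_ : shifted_step (gamma - gamma / p) x h g =
  xhat - (gamma / p) *: h - (xs - (gamma / p) *: F xs)); last first.
  by apply/rowP => i; rewrite /shifted_step !mxE; ring.
apply: le_trans H; rewrite lerD2l le_eqVlt; apply/orP; left; apply/eqP.
rewrite !enorm_sqr expr2 -mulrA -dotvZr -dotvZl.
suff -> : (gamma / p) *: (h' - F xs) =
  x' - xs - (xhat - (gamma / p) *: h - (xs - (gamma / p) *: F xs)) by [].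
by apply/rowP => i; rewrite h'E !mxE; field; rewrite !gt_eqF.
Qed.

(** The shifts average to zero, p (gamma - gamma / p) + (1 - p) gamma = 0, which
    cancels the inner product of the unshifted step with h - F xs. *)
Lemma coin_average (x h g : 'rV[R]_n) :
  p * dotv (shifted_step (gamma - gamma / p) x h g) (shifted_step (gamma - gamma / p) x h g)
  + (1 - p) * (dotv (shifted_step gamma x h g) (shifted_step gamma x h g)
     + (gamma / p) ^+ 2 * dotv (h - F xs) (h - F xs)) =
  dotv (shifted_step 0 x h g) (shifted_step 0 x h g)
  + (1 - p ^+ 2) * (gamma / p) ^+ 2 * dotv (h - F xs) (h - F xs).
Proof.
rewrite /shifted_step; move: (x - xs) (g - F xs) (h - F xs) => u v k.
rewrite !dotv_bilin !(dotvC v u) !(dotvC k u) !(dotvC k v).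
by field; rewrite gt_eqF.
Qed.

(** A crude bound, used only to see that the means are finite. *)
Lemma shifted_step_sqr_le e (x h g : 'rV[R]_n) :
  dotv (shifted_step e x h g) (shifted_step e x h g) <=
  3 * dotv (x - xs) (x - xs) + 3 * gamma ^+ 2 * dotv (g - F xs) (g - F xs)
  + 3 * e ^+ 2 * dotv (h - F xs) (h - F xs).
Proof.
rewrite /shifted_step; move: (x - xs) (g - F xs) (h - F xs) => u v k.
have H1 := dotv_ge0 (u + gamma *: v); have H2 := dotv_ge0 (u - e *: k).
have H3 := dotv_ge0 (gamma *: v + e *: k); move: H1 H2 H3.
rewrite !dotv_bilin !(dotvC v u) !(dotvC k u) !(dotvC k v).
lra.
Qed.

Lemma shifted_step0_sqr (x h g : 'rV[R]_n) :
  dotv (shifted_step 0 x h g) (shifted_step 0 x h g) =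
  dotv (x - xs) (x - xs) - 2 * gamma * dotv (g - F xs) (x - xs)
  + gamma ^+ 2 * dotv (g - F xs) (g - F xs).
Proof.
rewrite /shifted_step scale0r addr0; move: (x - xs) (g - F xs) => u v.
by rewrite !dotv_bilin !(dotvC v u); ring.
Qed.

End coin_step.

(** * Expected descent of the Lyapunov function *)

Section one_step.
Context {R : realType} {n : nat} {d : measure_display} {Om : measurableType d}.
Variables (P : probability Om R).
Variables (F : 'rV[R]_n -> 'rV[R]_n) (xs : 'rV[R]_n) (mu ell : R).
Hypotheses (mu0 : 0 < mu) (ell0 : 0 < ell).
Hypotheses (qsm : quasi_strongly_monotone F xs mu) (sc : star_cocoercive F xs ell).
Variables (Ft : nat -> set (set Om)) (x h g : nat -> Om -> 'rV[R]_n).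
Variables (theta : nat -> Om -> bool) (sigma : nat -> Om -> R).
Variables (A B C D1 D2 rho : R).
Hypotheses (A0 : 0 <= A) (B0 : 0 <= B) (C0 : 0 <= C) (D10 : 0 <= D1)
  (D20 : 0 <= D2) (rho1 : rho <= 1).
Hypothesis est : estimator_assumption P F xs Ft x h g sigma A B C D1 D2 rho.

Let FtM t : Ft t `<=` measurable.
Proof. by case: (est_filtration est). Qed.

Let Ftsig t : sigma_algebra setT (Ft t).
Proof. by case: (est_filtration est). Qed.

Let FtE t : <<s Ft t >> = Ft t.
Proof. exact: sigma_algebra_id (Ftsig t). Qed.

Let x_adapted t : vadapted (Ft t) (x t).
Proof. by apply: sigma_vec_vadapted; rewrite FtE; case: (est_adapted est t). Qed.

Let h_adapted t : vadapted (Ft t) (h t).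
Proof. by apply: sigma_vec_vadapted; rewrite FtE; case: (est_adapted est t). Qed.

Let sigma_adapted t : adapted_to (Ft t) (sigma t).
Proof. by apply: preimage_adapted; rewrite FtE; case: (est_adapted est t). Qed.

Let x_meas t : vmeasurable (x t).
Proof. exact: vadapted_measurable (@FtM t) (@x_adapted t). Qed.

Let h_meas t : vmeasurable (h t).
Proof. exact: vadapted_measurable (@FtM t) (@h_adapted t). Qed.

Let sigma_meas t : measurable_fun setT (sigma t).
Proof. exact: adapted_measurable (@FtM t) _ _ _ (@sigma_adapted t). Qed.

Let g_meas t : vmeasurable (g t).
Proof. by move=> i; have [Y []] := est_unbiased est t i. Qed.

Let sqd (X : Om -> 'rV[R]_n) v w := dotv (X w - v) (X w - v).

Let sqd_meas X v : vmeasurable X -> measurable_fun setT (sqd X v).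
Proof.
move=> mX; have mXv : vmeasurable (fun w => X w - v) by exact: vmeasurable_shift.
exact: measurable_dotv.
Qed.

(** [F] is an arbitrary map, so F (x t) need not be measurable; the conditional
    expectation of the estimator provides an adapted vector that agrees with it
    almost surely and replaces it under integrals. *)
Lemma operator_version t : exists y : Om -> 'rV[R]_n,
  [/\ vadapted (Ft t) y, {ae P, forall w, y w = F (x t w)} &
    forall i E, Ft t E ->
      (\int[P]_(w in E) (g t w 0 i)%:E = \int[P]_(w in E) (y w 0 i)%:E)%E].
Proof.
have /choice[Y HY] i : exists Y, is_cond_exp P (Ft t) (fun w => g t w 0 i) Y /\
    {ae P, forall w, Y w = (F (x t w) 0 i)%:E}.
  by have [Y ? ?] := est_unbiased est t i; exists Y.
pose y w := \row_i fine (Y i w).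
have yE i : (fun w => y w 0 i) = fine \o Y i by apply/funext => w; rewrite mxE.
have aY i : adapted_to (Ft t) (Y i).
  by apply: preimage_adapted; rewrite FtE; case: (HY i) => -[].
have ay : vadapted (Ft t) y.
  by move=> i; rewrite yE; apply: measurableT_comp => //; exact: aY.
exists y; split=> //.
  have Yall : {ae P, forall w, forall i, Y i w = (F (x t w) 0 i)%:E}.
    by apply: filter_forall => i; case: (HY i).
  by apply: filterS Yall => w Yw; apply/rowP => i; rewrite mxE Yw.
move=> i E FE; have [[_ _ _ YX] YF] := HY i.
have mE : measurable E by exact: FtM FE.
rewrite -YX//; apply: ae_eq_integral => //.
- apply: measurable_funTS; exact: adapted_measurable (@FtM t) _ _ _ (aY i).
- apply/measurable_EFinP; apply: measurable_funTS.
  exact: (vadapted_measurable (@FtM t) ay).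
- by apply: filterS YF => w Yw _; rewrite mxE Yw.
Qed.

(** The number s is the mean of <F (x t) - F xs, x t - xs>, computed with the
    adapted version y of F (x t).  It is finite by star-cocoercivity, which makes
    the second moments of g finite; only then does the pull-out property apply
    and identify s as the mean of the inner product with g. *)
Lemma step_moments t nN ns :
  has_mean P (sqd (x t) xs) nN -> has_mean P (fun w => sigma t w ^+ 2) ns ->
  exists s m2 m3,
   [/\ mu * nN <= s,
       has_mean P (fun w => dotv (g t w - F xs) (x t w - xs)) s,
       has_mean P (sqd (g t) (F xs)) m2 /\ m2 <= 2 * A * s + B * ns + D1 &
       has_mean P (fun w => sigma t.+1 w ^+ 2) m3 /\
       m3 <= 2 * C * s + (1 - rho) * ns + D2].
Proof.
move=> meanN mean_s.
have [y [ay yF gy]] := operator_version t.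
have my := vadapted_measurable (@FtM t) ay.
have myF : vmeasurable (fun w => y w - F xs) by exact: vmeasurable_shift.
have mxxs : vmeasurable (fun w => x t w - xs) by exact: vmeasurable_shift.
pose S w := dotv (y w - F xs) (x t w - xs).
have mS : measurable_fun setT S by exact: measurable_dotv.
have S_lb : {ae P, forall w, mu * sqd (x t) xs w <= S w}.
  by apply: filterS yF => w yw; rewrite /S yw /sqd -enorm_sqr.
have S_ge0 : {ae P, forall w, 0 <= S w}.
  apply: filterS S_lb => w; apply: le_trans; rewrite mulr_ge0 ?dotv_ge0//.
  exact: ltW.
have [s mean_S] : exists s, has_mean P S s.
  apply: has_mean_dominated (has_meanZ ell meanN) => //.
  apply: filterS2 yF S_ge0 => w yw S0; rewrite ger0_norm//.
  by rewrite /S yw; exact: star_cocoercive_dotv_le.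
have [m2 mean_G m2le] : exists2 m2, has_mean P (sqd (g t) (F xs)) m2 &
    m2 <= 2 * A * s + B * ns + D1.
  have [Y YX Yle] := est_second_moment est t.
  apply: (cond_exp_mean_le (Ftsig t) (@FtM t) (Y := Y)
    (bound := fun w => 2 * A * S w + B * sigma t w ^+ 2 + D1)).
  - by move=> w; exact: dotv_ge0.
  - by move: YX; congr (is_cond_exp _ _ _ _); apply/funext => w; rewrite enorm_sqr.
  - apply: filterS3 yF S_ge0 Yle => w yw S0 Yw; split.
      rewrite !addr_ge0//; last exact: mulr_ge0 B0 (sqr_ge0 _).
      by apply: mulr_ge0 S0; exact: mulr_ge0.
    by rewrite /S yw.
  - apply: has_meanD (has_mean_cst _ _).
    exact: has_meanD (has_meanZ _ mean_S) (has_meanZ _ mean_s).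
have [m3 mean_s' m3le] : exists2 m3, has_mean P (fun w => sigma t.+1 w ^+ 2) m3 &
    m3 <= 2 * C * s + (1 - rho) * ns + D2.
  have [Y YX Yle] := est_sigma est t.
  apply: (cond_exp_mean_le (Ftsig t) (@FtM t) (Y := Y)
    (bound := fun w => 2 * C * S w + (1 - rho) * sigma t w ^+ 2 + D2)) => //.
  - by move=> w; exact: sqr_ge0.
  - apply: filterS3 yF S_ge0 Yle => w yw S0 Yw; split.
      rewrite !addr_ge0//.
        by apply: mulr_ge0 S0; exact: mulr_ge0.
      by apply: mulr_ge0 (sqr_ge0 _); rewrite subr_ge0.
    by rewrite /S yw.
  - apply: has_meanD (has_mean_cst _ _).
    exact: has_meanD (has_meanZ _ mean_S) (has_meanZ _ mean_s).
exists s, m2, m3; split=> //; first exact: le_has_mean S_lb (has_meanZ mu meanN) mean_S.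
have sqr_mean (X : Om -> 'rV[R]_n) m i : vmeasurable X ->
    has_mean P (fun w => dotv (X w) (X w)) m ->
    exists m', has_mean P (fun w => X w 0 i ^+ 2) m'.
  move=> mX; apply: has_mean_dominated; first exact: measurable_funX.
  by apply: aeW => w; rewrite ger0_norm ?sqr_ge0// sqr_coord_le.
have [k mean_yF] : exists k, has_mean P (fun w => dotv (y w - F xs) (y w - F xs)) k.
  apply: has_mean_dominated (has_meanZ (ell ^+ 2) meanN); first exact: measurable_dotv.
  apply: filterS yF => w yw; rewrite ger0_norm ?dotv_ge0// yw.
  exact: star_cocoercive_lipschitz.
have mgF : vmeasurable (fun w => g t w - F xs) by exact: vmeasurable_shift.
have /choice[m mm] i : exists m,
    has_mean P (fun w => (x t w - xs) 0 i * (g t w - F xs) 0 i) m /\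
    has_mean P (fun w => (x t w - xs) 0 i * (y w - F xs) 0 i) m.
  have [a1 mean1] := sqr_mean _ _ i mxxs meanN.
  have [a2 mean2] := sqr_mean _ _ i mgF mean_G.
  have [a3 mean3] := sqr_mean _ _ i myF mean_yF.
  apply: (pull_out (@FtM t) _ _ (mgF i) mean1 mean2 mean3).
  - exact: (vadapted_shift xs (@x_adapted t) i).
  - exact: (vadapted_shift (F xs) ay i).
  - rewrite FtE => E FE; have mE : measurable E by exact: FtM FE.
    have centered (X : Om -> 'rV[R]_n) m' : vmeasurable X ->
        has_mean P (fun w => (X w - F xs) 0 i ^+ 2) m' ->
        (\int[P]_(w in E) ((X w - F xs) 0 i)%:E =
         \int[P]_(w in E) (X w 0 i)%:E + \int[P]_(w in E) (- F xs 0 i)%:E)%E.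
      move=> mX Xsqr.
      have mXF : vmeasurable (fun w => X w - F xs) by exact: vmeasurable_shift.
      have [m'' Xm] := has_mean_of_sqr (mXF i) Xsqr.
      have [Xi _] : has_mean P (fun w => X w 0 i) (m'' + F xs 0 i).
        apply: (eq_has_mean _ (has_meanD Xm (has_mean_cst P (F xs 0 i)))) => w.
        by rewrite !mxE subrK.
      have onE f : P.-integrable setT f -> P.-integrable E f by apply: integrableS.
      rewrite -integralD//; [|exact: onE Xi|exact/onE/finite_measure_integrable_cst].
      by apply: eq_integral => w _; rewrite !mxE EFinD.
    by rewrite !(centered _ _ _ mean2, centered _ _ _ mean3)// gy.
have mean_S' : has_mean P S (\sum_i m i).
  apply: (eq_has_mean _ (has_mean_sum (fun i => (mm i).2))) => w.
  by rewrite /S dotvC.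
rewrite (has_mean_unique mean_S mean_S').
apply: (eq_has_mean _ (has_mean_sum (fun i => (mm i).1))) => w.
by rewrite dotvC.
Qed.

Variables (r : 'rV[R]_n -> \bar R) (x0 h0 : 'rV[R]_n) (M gamma p : R).
Hypotheses (sol : vip_solution F r xs) (rproper : proper_fun r)
  (rlsc : lower_semicontinuous r) (rconvex : convex_efun r).
Hypotheses (gamma0 : 0 < gamma) (p0 : 0 < p) (M0 : 0 < M).
Hypotheses (coins : fresh_coins P Ft g p theta).
Hypothesis alg : forall w, proxskip r gamma p x0 h0
  (fun t => g t w) (fun t => theta t w) (fun t => x t w) (fun t => h t w).

Let energy t w := enorm (x t w - xs) ^+ 2 + (gamma / p) ^+ 2 * enorm (h t w - F xs) ^+ 2.

(** The heads and tails bounds of [coin_step_le] depend only on x, h and g, so the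
    coin is independent of them and averages them with weights p and 1 - p; then
    [coin_average] and the expansion of the square apply. *)
Lemma coin_moment t nN nH s m2 :
  has_mean P (sqd (x t) xs) nN -> has_mean P (sqd (h t) (F xs)) nH ->
  has_mean P (fun w => dotv (g t w - F xs) (x t w - xs)) s ->
  has_mean P (sqd (g t) (F xs)) m2 ->
  exists2 q, has_mean P (energy t.+1) q &
    q <= nN - 2 * gamma * s + gamma ^+ 2 * m2 + (1 - p ^+ 2) * (gamma / p) ^+ 2 * nH.
Proof.
move=> meanN meanH mean_s meanG.
pose G := Ft t `|` sigma_vec (g t).
have GM : G `<=` measurable.
  by rewrite subUset; split; [exact: FtM|exact: sigma_vec_measurable].
have FtG : Ft t `<=` <<s G >> by move=> E FE; apply: sub_sigma_algebra; left.
have xG : vadapted G (x t).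
  apply: sigma_vec_vadapted => E xE.
  by case: (est_adapted est t) => sub _ _; exact: (FtG _ (sub _ _)).
have hG : vadapted G (h t).
  apply: sigma_vec_vadapted => E hE.
  by case: (est_adapted est t) => _ sub _; exact: (FtG _ (sub _ _)).
have gG : vadapted G (g t).
  by apply: sigma_vec_vadapted => E HE; apply: sub_sigma_algebra; right.
pose U e w := enorm (shifted_step F xs gamma e (x t w) (h t w) (g t w)) ^+ 2.
have UE e w : U e w = dotv (shifted_step F xs gamma e (x t w) (h t w) (g t w))
  (shifted_step F xs gamma e (x t w) (h t w) (g t w)) by exact: enorm_sqr.
have aU e : adapted_to G (U e).
  rewrite (_ : U e = fun w => dotv (shifted_step F xs gamma e (x t w) (h t w) (g t w))
    (shifted_step F xs gamma e (x t w) (h t w) (g t w))); last exact/funext/UE.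
  have aW : vadapted G (fun w => shifted_step F xs gamma e (x t w) (h t w) (g t w)).
    apply: vmeasurableD; last exact: vmeasurableZ (vadapted_shift (F xs) hG).
    apply: vmeasurableB; first exact: (vadapted_shift xs xG).
    exact: vmeasurableZ (vadapted_shift (F xs) gG).
  exact: (measurable_dotv aW aW).
have /choice[u mean_U] e : exists u, has_mean P (U e) u.
  apply: has_mean_dominated (has_meanD (has_meanD (has_meanZ 3 meanN)
    (has_meanZ (3 * gamma ^+ 2) meanG)) (has_meanZ (3 * e ^+ 2) meanH)).
    exact: adapted_measurable GM _ _ _ (aU e).
  apply: aeW => w; rewrite ger0_norm ?sqr_ge0// UE.
  exact: shifted_step_sqr_le.
have [mtheta ptheta ind] := coins t.
pose K := [set w | theta t w].
have KE : K = theta t @^-1` [set true] by [].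
have mK : measurable K by rewrite KE -[X in measurable X]setTI; exact: mtheta.
have indK E : <<s G >> E -> P (K `&` E) = (p%:E * P E)%E.
  move=> GE; rewrite -ptheta; apply: ind => //.
  by exists [set true] => //; rewrite setTI.
have mean_heads (W : Om -> R) m : adapted_to G W -> (forall w, 0 <= W w) ->
    has_mean P W m -> has_mean P (fun w => W w * \1_K w) (p * m).
  by move=> aW W0 Wm; apply: (has_mean_mul_indep GM) => //; exact: ltW.
pose T2 w := U gamma w + (gamma / p) ^+ 2 * sqd (h t) (F xs) w.
have aT2 : adapted_to G T2.
  apply: measurable_funD; first exact: aU.
  apply: measurable_funM => //.
  have ah := vadapted_shift (F xs) hG.
  exact: (measurable_dotv ah ah).
have T20 w : 0 <= T2 w.
  by apply: addr_ge0; [exact: sqr_ge0|exact: mulr_ge0 (sqr_ge0 _) (dotv_ge0 _)].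
have mean_T2 := has_meanD (mean_U gamma) (has_meanZ ((gamma / p) ^+ 2) meanH).
have mean_ub := has_meanD (mean_heads _ _ (aU _) (fun w => sqr_ge0 _)
    (mean_U (gamma - gamma / p)))
  (has_meanD mean_T2 (has_meanZ (-1) (mean_heads _ _ aT2 T20 mean_T2))).
have energy_le w : energy t.+1 w <= U (gamma - gamma / p) w * \1_K w +
    (T2 w + -1 * (T2 w * \1_K w)).
  have [_ _ /(_ t)[xE hE]] := alg w.
  apply: (le_trans (coin_step_le sol rproper rlsc rconvex gamma0 p0 xE hE)).
  rewrite /T2 /U /sqd -!enorm_sqr indicE.
  have -> : (w \in K) = theta t w by apply/idP/idP => [/set_mem|/mem_set].
  by case: (theta t w) => /=; lra.
have menergy : measurable_fun setT (energy t.+1).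
  rewrite /energy; under eq_fun do rewrite !enorm_sqr.
  apply: measurable_funD; first exact: sqd_meas.
  by apply: measurable_funM => //; exact: sqd_meas.
have [q mean_q] : exists q, has_mean P (energy t.+1) q.
  apply: has_mean_dominated mean_ub => //; apply: aeW => w.
  rewrite ger0_norm//; apply: addr_ge0; first exact: sqr_ge0.
  exact: mulr_ge0 (sqr_ge0 _) (sqr_ge0 _).
exists q => //.
apply: (le_trans (le_has_mean (aeW _ energy_le) mean_q mean_ub)).
have u0E : u 0 = nN + - (2 * gamma) * s + gamma ^+ 2 * m2.
  apply: has_mean_unique (mean_U 0) _.
  apply: (eq_has_mean _ (has_meanD (has_meanD meanN (has_meanZ (- (2 * gamma)) mean_s))
     (has_meanZ (gamma ^+ 2) meanG))) => w.
  by rewrite UE shifted_step0_sqr// /sqd; ring.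
have avgE : p * u (gamma - gamma / p) + (1 - p) * (u gamma + (gamma / p) ^+ 2 * nH) =
    u 0 + (1 - p ^+ 2) * (gamma / p) ^+ 2 * nH.
  apply: has_mean_unique (has_meanD (has_meanZ p (mean_U _)) (has_meanZ (1 - p) mean_T2)) _.
  apply: (eq_has_mean _ (has_meanD (mean_U 0)
    (has_meanZ ((1 - p ^+ 2) * (gamma / p) ^+ 2) meanH))) => w.
  by rewrite !UE /sqd coin_average.
by rewrite le_eqVlt; apply/orP; left; apply/eqP; lra.
Qed.

Hypothesis (step_A : 2 * gamma * (A + M * C) <= 1).

Let V t w := lyapunov F xs gamma p M (x t w) (h t w) (sigma t w).

(** Each of the three parts of V has its own contraction factor: 1 - gamma mu for
    the iterates, 1 - p^2 for the control vectors and 1 - rho + B / M for sigma.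
    By [step_A] the moment bounds consume at most half of - 2 gamma s, and the
    other half is at most - gamma mu E|x t - xs|^2 by quasi-strong monotonicity. *)
Lemma lyapunov_descent tau t v :
  tau <= gamma * mu -> tau <= p ^+ 2 -> tau <= rho - B / M ->
  has_mean P (V t) v ->
  exists2 v', has_mean P (V t.+1) v' &
    v' <= (1 - tau) * v + gamma ^+ 2 * (D1 + M * D2).
Proof.
move=> tau_mu tau_p tau_rho meanV.
have gp0 : 0 < gamma / p by rewrite divr_gt0.
have VE w : V t w = sqd (x t) xs w + (gamma / p) ^+ 2 * sqd (h t) (F xs) w +
    M * gamma ^+ 2 * sigma t w ^+ 2 by rewrite /V /lyapunov !enorm_sqr.
have N0 w : 0 <= sqd (x t) xs w by exact: dotv_ge0.
have H0 w : 0 <= (gamma / p) ^+ 2 * sqd (h t) (F xs) w.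
  exact: mulr_ge0 (sqr_ge0 _) (dotv_ge0 _).
have s0 w : 0 <= M * gamma ^+ 2 * sigma t w ^+ 2.
  apply: mulr_ge0 (sqr_ge0 _); exact: mulr_ge0 (ltW M0) (sqr_ge0 _).
have [nN meanN] : exists m, has_mean P (sqd (x t) xs) m.
  apply: has_mean_dominated meanV; first exact: sqd_meas.
  apply: aeW => w; rewrite ger0_norm// VE.
  by have := H0 w; have := s0 w; lra.
have [nH meanH] : exists m, has_mean P (sqd (h t) (F xs)) m.
  apply: has_mean_dominated (has_meanZ ((gamma / p) ^- 2) meanV); first exact: sqd_meas.
  apply: aeW => w; rewrite ger0_norm ?dotv_ge0// ler_pdivlMl ?exprn_gt0// VE.
  by have := N0 w; have := s0 w; lra.
have [ns mean_s] : exists m, has_mean P (fun w => sigma t w ^+ 2) m.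
  apply: has_mean_dominated (has_meanZ (M * gamma ^+ 2)^-1 meanV).
    exact: measurable_funX.
  apply: aeW => w; rewrite ger0_norm ?sqr_ge0// ler_pdivlMl ?mulr_gt0 ?exprn_gt0// VE.
  by have := N0 w; have := H0 w; lra.
have vE : v = nN + (gamma / p) ^+ 2 * nH + M * gamma ^+ 2 * ns.
  apply: has_mean_unique meanV _.
  exact: (eq_has_mean (fun w => esym (VE w)) (has_meanD (has_meanD meanN
    (has_meanZ _ meanH)) (has_meanZ _ mean_s))).
have [s [m2 [m3 [s_lb mean_inner [meanG m2_le] [mean_s' m3_le]]]]] :=
  step_moments meanN mean_s.
have [q mean_q q_le] := coin_moment meanN meanH mean_inner meanG.
exists (q + M * gamma ^+ 2 * m3).
  exact: (has_meanD mean_q (has_meanZ (M * gamma ^+ 2) mean_s')).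
have nN0 : 0 <= nN by apply: le_has_mean (has_mean_cst P 0) meanN; exact: aeW.
have nH0 : 0 <= nH.
  by apply: le_has_mean (has_mean_cst P 0) meanH; apply: aeW => w; exact: dotv_ge0.
have ns0 : 0 <= ns.
  by apply: le_has_mean (has_mean_cst P 0) mean_s; apply: aeW => w; exact: sqr_ge0.
have g2 : 0 <= gamma ^+ 2 by exact: sqr_ge0.
have s_ge0 : 0 <= s by apply: le_trans s_lb; rewrite mulr_ge0// ltW.
have e1 : gamma ^+ 2 * m2 <= gamma ^+ 2 * (2 * A * s + B * ns + D1) by exact: ler_wpM2l.
have e2 : M * gamma ^+ 2 * m3 <= M * gamma ^+ 2 * (2 * C * s + (1 - rho) * ns + D2).
  by apply: ler_wpM2l => //; rewrite mulr_ge0// ltW.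
have e3 : 2 * gamma * (A + M * C) * (gamma * s) <= 1 * (gamma * s).
  by apply: ler_wpM2r => //; rewrite mulr_ge0// ltW.
have e4 : gamma * (mu * nN) <= gamma * s by rewrite ler_pM2l.
have e5 : tau * nN <= gamma * mu * nN by exact: ler_wpM2r.
have e6 : tau * ((gamma / p) ^+ 2 * nH) <= p ^+ 2 * ((gamma / p) ^+ 2 * nH).
  by apply: ler_wpM2r => //; rewrite mulr_ge0// sqr_ge0.
have e7 : tau * (M * gamma ^+ 2 * ns) <= (rho - B / M) * (M * gamma ^+ 2 * ns).
  by apply: ler_wpM2r => //; rewrite !mulr_ge0// ltW.
have e8 : (rho - B / M) * (M * gamma ^+ 2 * ns) =
    rho * M * gamma ^+ 2 * ns - B * gamma ^+ 2 * ns.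
  by field; rewrite gt_eqF.
rewrite vE; move: e1 e2 e3 e4 e5 e6 e7 q_le; rewrite e8.
set gp := (gamma / p) ^+ 2.
lra.
Qed.

End one_step.

(** * The convergence bound *)

(** When A + MC = 0 the second bound on gamma is infinite, and the second
    conclusion holds trivially. *)
Lemma stepsize_bounds (R : realType) (mu A MC gamma : R) :
  0 < mu -> 0 <= A + MC -> 0 < gamma ->
  (gamma%:E <= mine (mu%:E)^-1 ((2 * (A + MC))%:E)^-1)%E ->
  gamma * mu <= 1 /\ 2 * gamma * (A + MC) <= 1.
Proof.
move=> mu0 K0 gamma0; rewrite le_min => /andP[]; rewrite !inver gt_eqF// lee_fin.
rewrite -[leRHS]mul1r ler_pdivlMr// => -> H; split=> //.
rewrite [2 * gamma]mulrC -mulrA.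
have [->|K_neq0] := eqVneq (2 * (A + MC)) 0; first by rewrite mulr0.
move: H; rewrite (negbTE K_neq0) lee_fin -[leRHS]mul1r ler_pdivlMr//.
by rewrite lt_neqAle eq_sym K_neq0 mulr_ge0.
Qed.

(** The constant c / tau is the fixed point of v |-> (1 - tau) v + c. *)
Lemma geometric_recursion (R : realType) (tau c a v v' : R) (T : nat) :
  0 < tau -> tau <= 1 -> v <= (1 - tau) ^+ T * a + c / tau ->
  v' <= (1 - tau) * v + c -> v' <= (1 - tau) ^+ T.+1 * a + c / tau.
Proof.
move=> tau0 tau1 vle v'le; apply: (le_trans v'le).
have : (1 - tau) * v <= (1 - tau) * ((1 - tau) ^+ T * a + c / tau).
  by apply: ler_wpM2l => //; rewrite subr_ge0.
have -> : (1 - tau) * ((1 - tau) ^+ T * a + c / tau) =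
    (1 - tau) ^+ T.+1 * a + c / tau - c.
  by rewrite exprS; field; rewrite gt_eqF.
lra.
Qed.

Theorem theorem3p1 (R : realType) (n : nat)
  (F : 'rV[R]_n -> 'rV[R]_n) (r : 'rV[R]_n -> \bar R) (xs : 'rV[R]_n)
  (mu ell : R)
  (d : measure_display) (Om : measurableType d) (P : probability Om R)
  (Ft : nat -> set (set Om))
  (x h g : nat -> Om -> 'rV[R]_n) (theta : nat -> Om -> bool)
  (sigma : nat -> Om -> R) (x0 h0 : 'rV[R]_n) (sigma0 : R)
  (A B C D1 D2 rho M gamma p : R)
  (Hsol : unique (vip_solution F r) xs)
  (Hmu : 0 < mu) (Hell : 0 < ell)
  (Hqsm : quasi_strongly_monotone F xs mu)
  (Hsc : star_cocoercive F xs ell)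
  (Hproper : proper_fun r) (Hlsc : lower_semicontinuous r)
  (Hconvex : convex_efun r)
  (HA : 0 <= A) (HB : 0 <= B) (HC : 0 <= C) (HD1 : 0 <= D1) (HD2 : 0 <= D2)
  (Hrho : 0 < rho <= 1)
  (Hp : 0 < p <= 1)
  (HM : B / rho < M)
  (Hgamma0 : 0 < gamma)
  (Hgamma : (gamma%:E <= mine (mu%:E)^-1 ((2 * (A + M * C))%:E)^-1)%E)
  (Hest : estimator_assumption P F xs Ft x h g sigma A B C D1 D2 rho)
  (Hsigma0 : forall w, sigma 0%N w = sigma0)
  (Hcoins : fresh_coins P Ft g p theta)
  (Halg : forall w, proxskip r gamma p x0 h0
     (fun t => g t w) (fun t => theta t w) (fun t => x t w) (fun t => h t w)) :
  let tau := Num.min (gamma * mu) (Num.min (p ^+ 2) (rho - B / M)) in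
  let V (t : nat) (w : Om) :=
    lyapunov F xs gamma p M (x t w) (h t w) (sigma t w) in
  let V0 := lyapunov F xs gamma p M x0 h0 sigma0 in
  forall T : nat,
    ('E_P[V T] <=
      ((1 - tau) ^+ T * V0 + gamma ^+ 2 * (D1 + M * D2) / tau)%:E)%E.
Proof.
move=> tau V V0 T.
case/andP: Hrho => rho0 rho1; case/andP: Hp => p0 p1; case: Hsol => sol _.
have M0 : 0 < M by apply: le_lt_trans HM; rewrite divr_ge0// ltW.
have [step_mu step_A] := stepsize_bounds Hmu (addr_ge0 HA (mulr_ge0 (ltW M0) HC))
  Hgamma0 Hgamma.
have tau0 : 0 < tau.
  rewrite !lt_min mulr_gt0// exprn_gt0// subr_gt0 ltr_pdivrMr// mulrC.
  by rewrite -ltr_pdivrMr.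
have [tau_mu tau_p tau_rho] :
    [/\ tau <= gamma * mu, tau <= p ^+ 2 & tau <= rho - B / M].
  by split; rewrite /tau !ge_min lexx ?orbT.
have tau1 : tau <= 1 by exact: le_trans tau_mu step_mu.
have [v [_ meanV] v_le] : exists2 v, has_mean P (V T) v &
    v <= (1 - tau) ^+ T * V0 + gamma ^+ 2 * (D1 + M * D2) / tau.
  elim: T => [|T [v meanV v_le]].
    exists V0.
      apply: (eq_has_mean _ (has_mean_cst P V0)) => w.
      by have [xE hE _] := Halg w; rewrite /V xE hE Hsigma0.
    rewrite expr0 mul1r lerDl; apply: mulr_ge0; last by rewrite invr_ge0 ltW.
    by rewrite mulr_ge0 ?sqr_ge0// addr_ge0// mulr_ge0// ltW.
  have [v' meanV' v'_le] := lyapunov_descent Hmu Hell Hqsm Hsc HA HB HC HD1 HD2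
    rho1 Hest sol Hproper Hlsc Hconvex Hgamma0 p0 M0 Hcoins Halg step_A
    tau_mu tau_p tau_rho meanV.
  by exists v' => //; exact: geometric_recursion v_le v'_le.
by rewrite unlock meanV lee_fin.
Qed.
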